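(* Let $P$ be a finite poset, let $c$ be the maximal cardinality of an antichain in $P$, let $\Bbbk$ be a field, $n\ge1$, and let $R=\bigcup_{j=1}^n\{j\}\times R_j\subseteq[n]\times P$ with all $R_j$ nonempty. The multidegree $R$ occurs in the last, i.e. the $(c(n-1)+1)$-, linear strand of $L(n,P)$ if for each $j=1,\dots,n-1$: $R_j\le R_{j+1}$, the sets $\max(R_j)$ and $\min(R_{j+1})$ have the same cardinality $c$, and there is a one-to-one correspondence between these two sets such that the corresponding pairs of elements are the only comparability relations between them (that is, a bijection $\varphi:\max(R_j)\to\min(R_{j+1})$ such that $p\in\max(R_j)$ and $q\in\min(R_{j+1})$ are comparable in $P$ iff $q=\varphi(p)$). The Betti number $\beta_{i,R}(L(n,P))$ in this case, with $i=|R|-(c(n-1)+1)$, is $1$.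
   Context: $[n]=\{1<\dots<n\}$. The $n$'th letterplace ideal $L(n,P)$ is the ideal in $S=\Bbbk[x_{i,p}:(i,p)\in[n]\times P]$ generated by the monomials $x_{1,p_1}x_{2,p_2}\cdots x_{n,p_n}$ with $p_1\le p_2\le\cdots\le p_n$ in $P$; its Castelnuovo-Mumford regularity is known to be $c(n-1)+1$. For $R\subseteq[n]\times P$, $\beta_{i,R}(L(n,P))=\dim_\Bbbk\mathrm{Tor}_i^S(L(n,P),\Bbbk)_R$, where the multidegree $R$ means the $0/1$ exponent vector with support $R$. The Betti number $\beta_{i,R}$ is said to be in the $(|R|-i)$-linear strand; $R$ occurs in the $j$-linear strand if $\beta_{|R|-j,R}\ne0$. $\max(A)$ and $\min(A)$ denote the sets of maximal, respectively minimal, elements of $A\subseteq P$. For nonempty subsets $A,B$ of $P$ write $A\le B$ if: for every $a\in\max(A)$ there is $b\in\min(B)$ with $a\le b$, and for every $b\in\min(B)$ there is $a\in\max(A)$ with $a\le b$. *)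

(* Defs.v *)
From HB Require Import structures.
From mathcomp Require Import all_boot all_order all_algebra.
From mathcomp Require Import mpoly.

Set Implicit Arguments.
Unset Strict Implicit.
Unset Printing Implicit Defensive.

Import Order.TTheory GRing.Theory.
Local Open Scope ring_scope.

(* [subquotient_dim Z B d]: for subspaces B <= Z of V, dim_k (Z / B) = d,
   i.e. some d vectors of Z induce a basis of Z / B. *)
Definition subquotient_dim (k : fieldType) (V : lmodType k)
    (Z B : V -> Prop) (d : nat) : Prop :=
  exists z : 'I_d -> V, (forall j, Z (z j)) /\
    forall v, Z v ->
      exists! c : {ffun 'I_d -> k}, B (v - \sum_(j < d) c j *: z j).

Definition ideal_span (k : fieldType) (N : nat) (I : finType)
    (m : I -> {mpoly k[N]}) (A : pred I) (f : {mpoly k[N]}) : Prop :=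
  exists g : I -> {mpoly k[N]}, f = \sum_(u | A u) g u * m u.

(* Tor over S = k[X_0, .., X_(N-1)] is computed from the Koszul resolution
   K of k: K_i is free on the e_F, with F an i-subset of the variables, e_F has
   multidegree F, and d e_F = \sum_(x in F) +- X_x e_(F \ x).  The function f
   stands for the chain \sum_F f(F) e_F; for an ideal L of S, the tensor
   product of L and K_i consists of the chains with coefficients in L. *)
Section Koszul.

Variables (k : fieldType) (N : nat).
Local Notation S := {mpoly k[N]}.
Local Notation chain := {ffun {set 'I_N} -> S}.

Definition koszul_sign (x : 'I_N) (F : {set 'I_N}) : k :=
  (-1) ^+ #|[set y in F | (y < x)%N]|.

Definition koszul_diff (f : chain) : chain :=
  [ffun G : {set 'I_N} =>
     \sum_(x | x \notin G) koszul_sign x G *: ('X_x * f (x |: G))].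

Definition koszul_chain (L : S -> Prop) (i : nat) (a : 'X_{1..N})
    (f : chain) : Prop :=
  [/\ forall F, L (f F),
      forall F : {set 'I_N}, #|F| != i -> f F = 0
    & forall F m, m \in msupp (f F) -> (m + mesym1 F)%MM = a].

Definition koszul_cycle L i a (f : chain) : Prop :=
  koszul_chain L i a f /\ koszul_diff f = 0.

Definition koszul_boundary L i a (f : chain) : Prop :=
  exists2 g, koszul_chain L i.+1 a g & f = koszul_diff g.

(* [Tor_dim L i a b]: dim_k Tor_i^S(L, k)_a = b. *)
Definition Tor_dim (L : S -> Prop) (i : nat) (a : 'X_{1..N}) (b : nat) : Prop :=
  subquotient_dim (koszul_cycle L i a) (koszul_boundary L i a) b.

Lemma koszul_sign_swap x y (G : {set 'I_N}) : x \notin G -> y \notin G ->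
  x != y -> koszul_sign x G * koszul_sign y (x |: G) =
            - (koszul_sign y G * koszul_sign x (y |: G)).
Proof.
have key (u v : 'I_N) : u \notin G -> (u < v)%N ->
    koszul_sign v (u |: G) = - koszul_sign v G
    /\ koszul_sign u (v |: G) = koszul_sign u G.
  move=> uG ltuv; rewrite /koszul_sign; split.
    have -> : [set z in u |: G | (z < v)%N] = u |: [set z in G | (z < v)%N].
      apply/setP=> z; rewrite !inE; case: eqP => [->|] //=; by rewrite ltuv.
    by rewrite cardsU1 !inE (negPf uG) /= exprS mulN1r.
  congr (_ ^+ #|pred_of_set _|); apply/setP=> z; rewrite !inE.
  by case: eqP => [->|] //=; rewrite ltnNge (ltnW ltuv) andbF.
move=> xG yG; rewrite neq_ltn => /orP[] lt.
  by have [-> ->] := key _ _ xG lt; rewrite mulrN mulrC.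
by have [-> ->] := key _ _ yG lt; rewrite mulrN opprK mulrC.
Qed.

Lemma koszul_signK x (G : {set 'I_N}) : koszul_sign x G * koszul_sign x G = 1.
Proof. by rewrite /koszul_sign -exprD addnn -mul2n exprM sqrrN expr1n expr1n. Qed.

Lemma koszul_diffK f : koszul_diff (koszul_diff f) = 0.
Proof.
apply/ffunP=> G; rewrite !ffunE.
pose t x y : S := (koszul_sign x G * koszul_sign y (x |: G)) *:
                  ('X_x * 'X_y * f (y |: (x |: G))).
pose A x y := [&& x \notin G, y \notin G & x != y].
have -> : \sum_(x | x \notin G) koszul_sign x G *: ('X_x * koszul_diff f (x |: G))
        = \sum_x \sum_(y | A x y) t x y.
  rewrite big_mkcond; apply: eq_bigr => x _; rewrite /A.
  case: ifP => xG; last by rewrite big_pred0.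
  rewrite ffunE mulr_sumr scaler_sumr; apply: eq_big => [y|y _].
    by rewrite !inE negb_or andbC eq_sym.
  by rewrite /t -scalerAr scalerA mulrA.
have tN x y : A x y -> t x y = - t y x.
  case/and3P=> xG yG xy; rewrite /t koszul_sign_swap // scaleNr.
  by rewrite setUCA [_ * 'X_y]mulrC.
have -> : \sum_x \sum_(y | A x y) t x y =
   \sum_x \sum_(y | A x y && (x < y)%N) t x y
   + \sum_x \sum_(y | A x y && (y < x)%N) t x y.
  rewrite -big_split; apply: eq_bigr => x _ /=.
  rewrite (bigID (fun y : 'I_N => (x < y)%N)) /=; congr (_ + _).
  apply: eq_bigl => y; rewrite /A -leqNgt leq_eqVlt.
  case: (eqVneq x y) => [->|]; rewrite ?andbF //=.
  by rewrite eq_sym -val_eqE => /negPf->.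
rewrite [X in _ + X](exchange_big_dep xpredT) //= -big_split big1 //= => x _.
have AC y : A y x = A x y by rewrite /A eq_sym andbCA.
under [X in _ + X]eq_bigl do rewrite AC.
rewrite -big_split big1 //= => y /andP[Axy _].
by rewrite (tN _ _ Axy) addNr.
Qed.

(* p / X_x, when X_x divides p. *)
Let divX (x : 'I_N) (p : S) : S :=
  \sum_(m <- msupp p) p@_m *: 'X_[m - U_(x)].

Let divXK x p : (forall m, m \in msupp p -> (0 < m x)%N) -> 'X_x * divX x p = p.
Proof.
move=> px; rewrite [RHS]mpolyE mulr_sumr !big_seq; apply: eq_bigr => m pm.
by rewrite -scalerAr -mpolyXD addmC submK // lep1mP -lt0n px.
Qed.

Let msupp_divX x p m : m \in msupp (divX x p) ->
  exists2 m', m' \in msupp p & m = (m' - U_(x))%MM.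
Proof.
move/msupp_sum_le/flatten_mapP => [m']; rewrite filter_predT => pm' /msuppZ_le.
by rewrite msuppX inE => /eqP; exists m'.
Qed.

Let mesymD1 (x : 'I_N) (F : {set 'I_N}) :
  x \in F -> mesym1 F = (mesym1 (F :\ x) + U_(x))%MM.
Proof.
move=> xF; apply/mnmP => y; rewrite mnmDE !mnmE !inE eq_sym.
by case: eqP => [<-|_]; rewrite ?xF ?addn0.
Qed.

Lemma koszul_exact i a f : a != 0%MM ->
  koszul_cycle (fun=> True) i a f -> koszul_boundary (fun=> True) i a f.
Proof.
move=> a0 [[_ f0 fa] df0].
have [x ax] : exists x, (0 < a x)%N.
  apply/existsP; apply: contraNT a0; rewrite negb_exists => /forallP a0.
  by apply/eqP/mnmP => x; have := a0 x; rewrite lt0n negbK mnm0E => /eqP.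
have fx (F : {set 'I_N}) m : x \notin F -> m \in msupp (f F) -> (0 < m x)%N.
  move=> xF /fa am; move: ax; rewrite -am mnmDE mnmE (negPf xF) addn0 //.
have fK (F : {set 'I_N}) : x \notin F -> 'X_x * divX x (f F) = f F.
  by move=> xF; apply: divXK => m; apply: fx.
pose g : chain := [ffun F : {set 'I_N} => if x \in F
  then koszul_sign x (F :\ x) *: divX x (f (F :\ x)) else 0].
exists g.
  split=> // F; rewrite ffunE; case: ifP => // xF; last first.
  - by move=> m; rewrite msupp0.
  - move=> m /msuppZ_le/msupp_divX[m' m'f ->].
    have m'x : (0 < m' x)%N by apply: fx m'f; rewrite !inE eqxx.
    rewrite -(fa _ _ m'f) (mesymD1 xF) [(mesym1 _ + _)%MM]addmC addmA submK //.
    by rewrite lep1mP -lt0n.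
  move=> Fi; rewrite f0 ?/divX ?msupp0 ?big_nil ?scaler0 //.
  by apply: contra Fi; rewrite (cardsD1 x F) xF => /eqP->.
apply/ffunP => G; rewrite ffunE.
have [xG|xG] := boolP (x \in G); last first.
  rewrite (bigD1 x) //= big1 ?addr0 => [|y /andP[yG yx]].
    by rewrite ffunE setU11 setU1K // -scalerAr scalerA koszul_signK scale1r fK.
  by rewrite ffunE !inE (negPf xG) eq_sym (negPf yx) mulr0 scaler0.
pose H := G :\ x.
have xH : x \notin H by rewrite !inE eqxx.
have GE : G = x |: H by rewrite setD1K.
have := congr1 (fun h : chain => h H) df0.
rewrite /= !ffunE (bigD1 x) //= -GE => /eqP; rewrite addr_eq0 => /eqP dH.
have X0 : 'X_x != 0 :> S by rewrite -msupp_eq0 msuppX.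
apply: (mulfI X0).
have -> : 'X_x * f G = koszul_sign x H *: (koszul_sign x H *: ('X_x * f G)).
  by rewrite scalerA koszul_signK scale1r.
rewrite dH scalerN scaler_sumr mulr_sumr -sumrN.
apply: eq_big => [y|y /andP[yH yx]].
  by rewrite GE !inE negb_or andbC; case: eqP => //= ->; rewrite ?eqxx.
have xyH : x \notin y |: H by rewrite !inE eq_sym (negPf yx) eqxx.
rewrite ffunE !inE xG orbT.
have -> : (y |: G) :\ x = y |: H by rewrite GE setUCA setU1K.
rewrite -!scalerAr scalerA mulrCA fK // scalerA -scaleNr; congr (_ *: _).
rewrite GE -[RHS]mul1r -(koszul_signK x H) -!mulrA [_ * (_ * koszul_sign _ _)]mulrA.
rewrite koszul_sign_swap // 1?eq_sym // mulNr mulrN -mulrA.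
by rewrite koszul_signK mulr1.
Qed.

(* K is a resolution of k: its homology is k, in homological degree 0 and
   multidegree 0. *)
Lemma koszul_resolution i a :
  Tor_dim (fun=> True) i a ((i == 0%N) && (a == 0%MM)).
Proof.
have [->|a0] := eqVneq a 0%MM; last first.
  rewrite andbF; exists (fun=> 0); split=> [[]//|v /(koszul_exact a0) Bv].
  exists [ffun=> 0]; split; first by rewrite big_ord0 subr0.
  by move=> c _; apply/ffunP => [[]].
have chain0 j f (F : {set 'I_N}) : koszul_chain (fun=> True) j 0%MM f ->
    (0 < j)%N || (F != set0) -> f F = 0.
  move=> [_ f0 fa] jF; have [F0|nF] := eqVneq F set0.
    by apply: f0; rewrite F0 cards0 neq_ltn; move: jF; rewrite F0 eqxx orbF => ->.
  apply/eqP; rewrite -msupp_eq0; apply/eqP; case E: (msupp _) => [//|m s].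
  have /fa/eqP : m \in msupp (f F) by rewrite E mem_head.
  by rewrite mnmD_eq0 -mdeg_eq0 -[X in _ && X]mdeg_eq0 mdeg_mesym1 cards_eq0
    (negPf nF) andbF.
have diff0 : koszul_diff 0 = 0.
  by apply/ffunP=> F; rewrite !ffunE big1 // => x _; rewrite ffunE mulr0 scaler0.
have B0 j : koszul_boundary (fun=> True) j 0%MM 0.
  exists 0; last by rewrite diff0.
  by split=> // F; rewrite !ffunE // => m; rewrite msupp0.
have BE j f : koszul_boundary (fun=> True) j 0%MM f -> f = 0.
  case=> g gc ->; suff -> : g = 0 by [].
  by apply/ffunP=> F; rewrite (chain0 _ _ _ gc) // ffunE.
rewrite andbT; case: (posnP i) => [->|i0].
  have diff_deg0 f : koszul_chain (fun=> True) 0 0%MM f -> koszul_diff f = 0.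
    move=> fc; apply/ffunP=> F; rewrite !ffunE big1 // => x _.
    rewrite (chain0 _ _ _ fc) ?mulr0 ?scaler0 //.
    by apply/set0Pn; exists x; rewrite setU11.
  pose e : chain := [ffun F : {set 'I_N} => (F == set0)%:R].
  have ec : koszul_chain (fun=> True) 0 0%MM e.
    split=> // F; rewrite ffunE; first by rewrite cards_eq0 => /negPf->.
    case: eqP => [->|_] m; last by rewrite msupp0.
    by rewrite msupp1 inE => /eqP->; rewrite mesym1_set0 addm0.
  exists (fun=> e); split=> [j|v [vc _]]; first by split; last exact: diff_deg0.
  have vE : v = (v set0)@_0%MM *: e.
    apply/ffunP=> F; rewrite !ffunE; case: eqP => [->|/eqP F0]; last first.
      by rewrite (chain0 _ _ _ vc) ?F0 ?scaler0.
    apply/mpolyP=> m; rewrite mcoeffZ mcoeff1 mulr_natr.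
    case: (eqVneq m 0%MM) => [->|m0] //; rewrite mulr0n.
    apply: memN_msupp_eq0; apply/negP; case: vc => _ _ va /va/eqP.
    by rewrite mesym1_set0 addm0 (negPf m0).
  exists [ffun=> (v set0)@_0%MM]; split.
    by rewrite big_ord1 ffunE -vE subrr; apply: B0.
  move=> c /BE; rewrite big_ord1 => /eqP; rewrite subr_eq0 => /eqP vc'.
  apply/ffunP=> j; rewrite ord1 ffunE vc' !ffunE eqxx.
  by rewrite mcoeffZ mcoeff1 eqxx mulr1.
exists (fun=> 0); split=> [[]//|v [vc _]].
have -> : v = 0 by apply/ffunP=> F; rewrite (chain0 _ _ _ vc) ?i0 // ffunE.
exists [ffun=> 0]; split; first by rewrite big_ord0 subr0; apply: B0.
by move=> c _; apply/ffunP => [[]].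
Qed.

End Koszul.

Section Poset.

Variables (d : Order.disp_t) (P : finPOrderType d).

Definition max_elts (A : {set P}) : {set P} :=
  [set a in A | [forall b in A, (a <= b)%O ==> (b == a)]].

Definition min_elts (A : {set P}) : {set P} :=
  [set a in A | [forall b in A, (b <= a)%O ==> (b == a)]].

Definition antichain (A : {set P}) : bool :=
  [forall a in A, forall b in A, (a <= b)%O ==> (a == b)].

Definition width : nat := \max_(A : {set P} | antichain A) #|A|.

Definition set_le (A B : {set P}) : Prop :=
  (forall a, a \in max_elts A -> exists2 b, b \in min_elts B & (a <= b)%O) /\
  (forall b, b \in min_elts B -> exists2 a, a \in max_elts A & (a <= b)%O).

(* A bijection phi : A -> B such that the comparability relations between A
   and B are exactly those between p and phi p. *)
Definition comparability_matching (A B : {set P}) : Prop :=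
  exists phi : P -> P,
    [/\ {in A &, injective phi}, phi @: A = B
      & forall p q, p \in A -> q \in B -> (p >=< q)%O <-> q = phi p].

End Poset.

Section Letterplace.

Variables (k : fieldType) (d : Order.disp_t) (P : finPOrderType d) (n : nat).

(* The variable x_(i, p), with the positions 1, .., n numbered from 0. *)
Definition lpvar (x : 'I_n * P) : 'I_#|{: 'I_n * P}| := enum_rank x.

Definition multichain (u : {ffun 'I_n -> P}) : bool :=
  [forall i : 'I_n, forall j : 'I_n, (i <= j)%N ==> (u i <= u j)%O].

Definition letterplace_ideal : {mpoly k[#|{: 'I_n * P}|]} -> Prop :=
  ideal_span (fun u : {ffun 'I_n -> P} => \prod_(i < n) 'X_(lpvar (i, u i)))
    multichain.

(* [betti i R b]: beta_(i, R) (L(n, P)) = b. *)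
Definition betti (i : nat) (R : {set 'I_n * P}) (b : nat) : Prop :=
  Tor_dim letterplace_ideal i (mesym1 (lpvar @: R)) b.

Definition occurs_in_strand (j : nat) (R : {set 'I_n * P}) : Prop :=
  exists i b, [/\ (i + j)%N = #|R|, betti i R b & b != 0%N].

End Letterplace.

Definition graph_set (n : nat) (T : finType) (R : 'I_n -> {set T}) :
  {set 'I_n * T} := [set x | x.2 \in R x.1].

(* Main.v *)
Require Import Defs.
From HB Require Import structures.
From mathcomp Require Import all_boot all_order all_algebra.
From mathcomp Require Import mpoly.

Set Implicit Arguments.
Unset Strict Implicit.
Unset Printing Implicit Defensive.
Import Order.TTheory GRing.Theory.
Local Open Scope ring_scope.

(** In the squarefree multidegree X = R a Koszul chain with coefficients in L is
a k-valued function on the faces F of X for which x^(X \ F) lies in L, and the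
Koszul differential becomes the simplicial boundary.  So Tor_i(L, k)_R is the
homology, in face cardinality i, of the simplicial complex of all F whose
complement in R contains a multichain p_1 <= ... <= p_n with p_j in R_j
([Tor_dim_family], [letterplace_idealP]).

This complex is collapsed to a single critical face by a discrete Morse matching,
one level at a time from the top.  For n > 1, at the last level, let C = min(R_n),
let T be the part of R_n outside F, and let B = max(R_(n-1)).
- If T contains some q not minimal in R_n, take m in C below q.  Whether m
  belongs to F is irrelevant, because any multichain ending in m can end in q instead.
- If T is a proper subset of C, then some m in C is missing from T.  Its partner b
  in B lies below no element of T, so whether b belongs to F is irrelevant.
- If T = C, every element of R_(n-1) lies below some element of B, hence below
  some element of T, so every multichain on the first n-1 levels extends.
In the first two cases the corresponding faces come in pairs {F, F + v} and
contribute no homology; the last case is the same complex for n-1, with F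
containing the |R_n| - c elements of R_n outside C.  For n = 1 the complex
consists of the proper subsets of R_1, the boundary of a simplex.  Altogether one
critical face remains, of cardinality |R| - c(n-1) - 1: the homology is
one-dimensional and sits in that degree.

The matching argument is carried out on convex families of faces.  For such a
family, a vertex v that can be toggled freely gives a contracting homotopy
([acyclic_toggle]); if a family is cut into a subcomplex and a quotient one of
which is acyclic, its homology is that of the other ([betti_acyclic_sub],
[betti_acyclic_quo]); iterating over vertices, a family has the homology of its
unique non-acyclic fiber ([betti_fiber]).  The inductive step over the levels is
[betti_multichain_family_step]. *)

(** * Dimensions of subquotients *)

(** A linear relation between cycles that is total on both sides and respects
boundaries induces an isomorphism of the quotients.  Relations rather than maps
are used because the comparisons below go sometimes along a restriction,
sometimes along an inclusion, sometimes along an embedding. *)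
Lemma subquotient_dim_rel (k : fieldType) (V V' : lmodType k)
    (Z B : V -> Prop) (Z' B' : V' -> Prop) (rel : V -> V' -> Prop) (b : nat) :
  (forall v w, rel v w -> [/\ Z v, Z' w & B v <-> B' w]) ->
  (forall a v w v' w', rel v w -> rel v' w' ->
     rel (a *: v + v') (a *: w + w')) ->
  (forall v, Z v -> exists w, rel v w) ->
  (forall w, Z' w -> exists v, rel v w) ->
  subquotient_dim Z' B' b -> subquotient_dim Z B b.
Proof.
move=> relZ rel_lin relV relV' [z' [Zz' basis]].
have [z relz] : exists z, forall j, rel (z j) (z' j).
  exact: (fin_all_exists (fun j => relV' _ (Zz' j))).
exists z; split=> [j|v /relV[w relvw]]; first by case: (relZ _ _ (relz j)).
have relB (c : {ffun 'I_b -> k}) :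
    B (v - \sum_(j < b) c j *: z j) <-> B' (w - \sum_(j < b) c j *: z' j).
  have /relZ[_ _ //] : rel (v - \sum_(j < b) c j *: z j)
                           (w - \sum_(j < b) c j *: z' j).
  elim/big_rec2: _ => [|j y' y _ IH]; first by rewrite !subr0.
  have := rel_lin (- c j) _ _ _ _ (relz j) IH.
  by rewrite !scaleNr !opprD !addrA ![_ - c j *: _]addrC.
have [_ /basis[c [Bc cuniq]] _] := relZ _ _ relvw.
by exists c; split=> [|c' /relB/cuniq//]; apply/relB.
Qed.

(** * Homology of a family of faces *)

Section FamilyHomology.

Variables (k : fieldType) (N : nat).
Local Notation face := {set 'I_N}.
Local Notation family := {set {set 'I_N}}.
Local Notation chain := {ffun {set 'I_N} -> k^o}.
Local Notation sign := (koszul_sign k).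
Implicit Types (Phi : family) (f g : chain) (F G H : face).

Definition diff f : chain :=
  [ffun G : face => \sum_(x | x \notin G) sign x G *: f (x |: G)].

Definition restrict Phi f : chain := [ffun F => if F \in Phi then f F else 0].

(** For a convex family this is the differential of the quotient of the complex
generated by the family by the faces outside it. *)
Definition bdry Phi f : chain := restrict Phi (diff f).

Definition is_chain Phi i f : Prop :=
  forall F, ~~ ((F \in Phi) && (#|F| == i)) -> f F = 0.

Definition is_cycle Phi i f : Prop := is_chain Phi i f /\ bdry Phi f = 0.

Definition is_boundary Phi i f : Prop :=
  exists2 g, is_chain Phi i.+1 g & f = bdry Phi g.

Definition family_betti Phi i b : Prop :=
  subquotient_dim (is_cycle Phi i) (is_boundary Phi i) b.

Definition acyclic Phi : Prop :=
  forall i f, is_cycle Phi i f -> is_boundary Phi i f.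

Definition convex Phi : Prop :=
  forall F G H, F \subset G -> G \subset H -> F \in Phi -> H \in Phi -> G \in Phi.

Fact restrict_linear Phi : linear (restrict Phi).
Proof.
move=> a f g; apply/ffunP => F; rewrite !ffunE; case: ifP => // _.
by rewrite scaler0 addr0.
Qed.

HB.instance Definition _ Phi :=
  GRing.isLinear.Build k chain chain _ (restrict Phi) (restrict_linear Phi).

Fact diff_linear : linear diff.
Proof.
move=> a f g; apply/ffunP => G; rewrite !ffunE scaler_sumr -big_split.
apply: eq_bigr => x _ /=; rewrite !ffunE scalerDr; congr (_ + _).
by rewrite !scalerA mulrC.
Qed.

Fact bdry_linear Phi : linear (bdry Phi).
Proof. by move=> a f g; rewrite /bdry diff_linear restrict_linear. Qed.

HB.instance Definition _ Phi :=
  GRing.isLinear.Build k chain chain _ (bdry Phi) (bdry_linear Phi).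

Lemma chain_lin Phi i a f g :
  is_chain Phi i f -> is_chain Phi i g -> is_chain Phi i (a *: f + g).
Proof. by move=> cf cg F nF; rewrite !ffunE cf ?cg // scaler0 addr0. Qed.

Lemma chain0 Phi i : is_chain Phi i 0.
Proof. by move=> F _; rewrite ffunE. Qed.

Lemma chainD Phi i f g :
  is_chain Phi i f -> is_chain Phi i g -> is_chain Phi i (f + g).
Proof. by move=> cf cg; rewrite -[f]scale1r; apply: chain_lin. Qed.

Lemma chainB Phi i f g :
  is_chain Phi i f -> is_chain Phi i g -> is_chain Phi i (f - g).
Proof. by move=> cf cg; rewrite addrC -scaleN1r; apply: chain_lin. Qed.

Lemma cycle_lin Phi i a f g :
  is_cycle Phi i f -> is_cycle Phi i g -> is_cycle Phi i (a *: f + g).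
Proof.
move=> [cf bf] [cg bg]; split; first exact: chain_lin.
by rewrite bdry_linear bf bg scaler0 addr0.
Qed.

Lemma boundary_lin Phi i a f g :
  is_boundary Phi i f -> is_boundary Phi i g -> is_boundary Phi i (a *: f + g).
Proof.
move=> [f' cf ->] [g' cg ->]; exists (a *: f' + g'); first exact: chain_lin.
by rewrite bdry_linear.
Qed.

Lemma boundaryB Phi i f g :
  is_boundary Phi i f -> is_boundary Phi i g -> is_boundary Phi i (f - g).
Proof. by move=> bf bg; rewrite addrC -scaleN1r; apply: boundary_lin. Qed.

Lemma boundary0 Phi i : is_boundary Phi i 0.
Proof. by exists 0; [apply: chain0 | rewrite raddf0]. Qed.

Lemma chain_out Phi i f F : is_chain Phi i f -> F \notin Phi -> f F = 0.
Proof. by move=> cf nF; rewrite cf // (negPf nF). Qed.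

Lemma restrict_id Phi i f : is_chain Phi i f -> restrict Phi f = f.
Proof.
by move=> cf; apply/ffunP => F; rewrite ffunE; case: ifPn => // /(chain_out cf).
Qed.

Lemma chain_bdry Phi i f : is_chain Phi i.+1 f -> is_chain Phi i (bdry Phi f).
Proof.
move=> cf G; rewrite negb_and ffunE; case: ifP => //= _ Gi.
rewrite ffunE big1 // => x xG; rewrite cf ?scaler0 //.
by rewrite cardsU1 xG eqSS (negPf Gi) andbF.
Qed.

Lemma bdry_deg0 Phi f : is_chain Phi 0 f -> bdry Phi f = 0.
Proof.
move=> cf; apply/ffunP => G; rewrite !ffunE; case: ifP => // _.
by rewrite big1 // => x xG; rewrite cf ?scaler0 // cardsU1 xG andbF.
Qed.

Lemma acyclicP Phi : acyclic Phi <-> forall i, family_betti Phi i 0.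
Proof.
split=> [acy i|dim0 i f cf].
  exists (fun=> 0); split=> [[]//|v /acy Bv].
  exists [ffun=> 0]; split; first by rewrite big_ord0 subr0.
  by move=> c _; apply/ffunP => [[]].
have [z [_ /(_ _ cf)[c []]]] := dim0 i.
by rewrite big_ord0 subr0.
Qed.

(** The Koszul chain of multidegree X whose coefficients are scalars times the only
monomials that the multidegree allows. *)
Definition monomial_chain (X : face) f : {ffun face -> {mpoly k[N]}} :=
  [ffun F => f F *: 'X_[mesym1 (X :\: F)]].

Lemma mesym1D1 (X : face) x : x \in X -> mesym1 X = (U_(x) + mesym1 (X :\ x))%MM.
Proof.
move=> xX; apply/mnmP => y; rewrite mnmDE mnm1E !mnmE !inE (eq_sym y x).
by case: eqP => [<-|_]; rewrite ?xX.
Qed.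

Lemma diff_monomial_chain (X : face) f : (forall F, ~~ (F \subset X) -> f F = 0) ->
  koszul_diff (monomial_chain X f) = monomial_chain X (diff f).
Proof.
move=> fX; apply/ffunP => G; rewrite !ffunE scaler_suml; apply: eq_bigr => x xG.
rewrite ffunE -scalerAr scalerA; have [xX|xX] := boolP (x \in X); last first.
  by rewrite fX ?mulr0 ?scaler0 ?scale0r // subUset sub1set (negPf xX).
rewrite -mpolyXD (@mesym1D1 (X :\: G) x) ?inE ?xG ?xX //.
congr (_ *: 'X_[_ + mesym1 _]); apply/setP => y; rewrite !inE negb_or -!andbA.
by [].
Qed.

Lemma monomial_chain_eq0 (X : face) f : monomial_chain X f = 0 -> f = 0.
Proof.
move=> f0; apply/ffunP => F; have := congr1 (fun h : {ffun _ -> _} => h F) f0.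
rewrite !ffunE => /eqP; rewrite scaler_eq0 => /orP[/eqP-> //|].
by rewrite -msupp_eq0 msuppX.
Qed.

(** Monomial chains carry the simplicial differential to the Koszul one, so the
square-zero property is inherited. *)
Lemma diffK f : diff (diff f) = 0.
Proof.
apply: (@monomial_chain_eq0 [set: 'I_N]).
have fT (h : chain) F : ~~ (F \subset [set: 'I_N]) -> h F = 0 by rewrite subsetT.
by rewrite -!diff_monomial_chain ?koszul_diffK //; apply: fT.
Qed.

(** In the square of the differential the intermediate face x |: G lies between two
faces of the family, so convexity makes the truncation harmless. *)
Lemma bdryK Phi i f : convex Phi -> is_chain Phi i f -> bdry Phi (bdry Phi f) = 0.
Proof.
move=> cvx cf; apply/ffunP => G; rewrite [RHS]ffunE ffunE; case: ifP => // GPhi.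
have <- : diff (diff f) G = 0 by rewrite diffK ffunE.
rewrite !ffunE; apply: eq_bigr => x xG; rewrite ffunE.
case: ifPn => // xGPhi; rewrite ffunE big1 // => y yxG.
rewrite (chain_out cf) ?scaler0 //; apply: contra xGPhi => yxGPhi.
by apply: cvx GPhi yxGPhi; apply: subsetUr.
Qed.

(** Dividing by v, i.e. moving the value at F :\ v to F, is a contracting
homotopy; freeness of v guarantees that it stays in the family. *)
Lemma acyclic_toggle Phi v :
  (forall F, v \notin F -> (v |: F \in Phi) = (F \in Phi)) -> acyclic Phi.
Proof.
move=> togg i f [cf bf].
pose g : chain := [ffun F : face =>
  if v \in F then sign v (F :\ v) *: f (F :\ v) else 0].
exists g.
  move=> F; rewrite ffunE; case: ifP => // vF nF.
  rewrite cf ?scaler0 //; apply: contra nF.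
  rewrite -togg ?setD1K // ?inE ?eqxx // => /andP[-> /eqP<-].
  by rewrite (cardsD1 v F) vF eqxx.
apply/ffunP => G; rewrite ffunE; case: ifPn => [GPhi|]; last exact: chain_out cf.
have [vG|vG] := boolP (v \in G); last first.
  rewrite ffunE (bigD1 v) //= big1 ?addr0 => [|x /andP[xG xv]].
    by rewrite ffunE setU11 setU1K // scalerA koszul_signK scale1r.
  by rewrite ffunE !inE (negPf vG) eq_sym (negPf xv) scaler0.
pose H := G :\ v; have vH : v \notin H by rewrite !inE eqxx.
have GE : G = v |: H by rewrite setD1K.
have HPhi : H \in Phi by rewrite -togg // -GE.
have := congr1 (fun h : chain => h H) bf.
rewrite /= !ffunE HPhi (bigD1 v) //= -GE => /eqP; rewrite addr_eq0 => /eqP dH.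
have -> : f G = sign v H *: (sign v H *: f G).
  by rewrite scalerA koszul_signK scale1r.
rewrite dH scalerN scaler_sumr -sumrN; apply: eq_big => [x|x /andP[xH xv]].
  by rewrite GE !inE negb_or andbC; case: eqP => //= ->; rewrite ?eqxx.
have vxH : v \notin x |: H by rewrite !inE eq_sym (negPf xv) eqxx.
rewrite ffunE !inE vG orbT.
have -> : (x |: G) :\ v = x |: H by rewrite GE setUCA setU1K.
rewrite !scalerA -scaleNr; congr (_ *: _).
rewrite GE -[RHS]mul1r -(koszul_signK k v H) -!mulrA.
rewrite [_ * (_ * koszul_sign _ _ _)]mulrA koszul_sign_swap // 1?eq_sym //.
by rewrite mulNr mulrN -mulrA koszul_signK mulr1.
Qed.

End FamilyHomology.

(** * Cutting a family into a subcomplex and a quotient *)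

Section Split.

Variables (k : fieldType) (N : nat).
Local Notation face := {set 'I_N}.
Local Notation family := {set {set 'I_N}}.
Local Notation chain := {ffun {set 'I_N} -> k^o}.
Implicit Types (Phi Psi : family) (f g : chain) (F G H : face).

Lemma chainS Psi Phi i f : Psi \subset Phi -> is_chain Psi i f -> is_chain Phi i f.
Proof.
move=> /subsetP sub cf F nF; apply: cf; apply: contra nF.
by case/andP => /sub -> ->.
Qed.

Lemma chain_restrict Psi Phi i f :
  is_chain Phi i f -> is_chain Psi i (restrict Psi f).
Proof.
move=> cf F nF; rewrite ffunE; case: ifP => // FPsi; apply: cf.
by apply: contra nF => /andP[_]; rewrite FPsi.
Qed.

Lemma family_betti_transfer Phi Psi i b
    (rel : chain -> chain -> Prop) :
  (forall v w, rel v w -> [/\ is_cycle Phi i v, is_cycle Psi i w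
     & is_boundary Phi i v <-> is_boundary Psi i w]) ->
  (forall a v w v' w', rel v w -> rel v' w' ->
     rel (a *: v + v') (a *: w + w')) ->
  (forall v, is_cycle Phi i v -> exists w, rel v w) ->
  (forall w, is_cycle Psi i w -> exists v, rel v w) ->
  family_betti k Psi i b -> family_betti k Phi i b.
Proof. exact: subquotient_dim_rel. Qed.

Variables (Phi D : family).
Hypothesis cvx : convex Phi.
Hypothesis downD : forall F G, F \subset G -> G \in D -> F \in D.

Local Notation Sub := (Phi :&: D).
Local Notation Quo := (Phi :\: D).

Lemma convex_sub : convex Sub.
Proof.
move=> F G H FG GH; rewrite !inE => /andP[FPhi _] /andP[HPhi HD].
by rewrite (cvx FG GH) //= (downD GH).
Qed.

Lemma convex_quo : convex Quo.
Proof.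
move=> F G H FG GH; rewrite !inE => /andP[FD FPhi] /andP[_ HPhi].
by rewrite (cvx FG GH) // andbT; apply: contra FD; apply: downD.
Qed.

Lemma bdry_sub i f : is_chain Sub i f -> bdry Phi f = bdry Sub f.
Proof.
move=> cf; apply/ffunP => G; rewrite !ffunE in_setI.
case: (G \in Phi) => //=; case: ifPn => // GD; rewrite big1 // => x _.
rewrite (chain_out cf) ?scaler0 // !inE negb_and; apply/orP; right.
by apply: contra GD; apply: downD; apply: subsetUr.
Qed.

Lemma restrict_quo_bdry i f :
  is_chain Phi i f -> restrict Quo (bdry Phi f) = bdry Quo (restrict Quo f).
Proof.
move=> cf; apply/ffunP => G; rewrite !ffunE in_setD.
have [GPhi|] := boolP (G \in Phi); rewrite ?andbF //=; case: ifP => // GD.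
rewrite andbT in GD; apply: eq_bigr => x _; rewrite ffunE in_setD.
case: ifPn => //; rewrite negb_and negbK => /orP[xGD|/(chain_out cf)-> //].
by case/negP: GD; apply: downD xGD; apply: subsetUr.
Qed.

Lemma chain_sub i f : is_chain Phi i f -> restrict Quo f = 0 -> is_chain Sub i f.
Proof.
move=> cf rf F; rewrite in_setI; have [FD|FD] := boolP (F \in D).
  by rewrite andbT => /cf.
move=> _; have [FPhi|/(chain_out cf)//] := boolP (F \in Phi).
have := congr1 (fun h : chain => h F) rf.
by rewrite /= !ffunE in_setD FD FPhi.
Qed.

(** The part of the long exact sequence of a pair that says that the homology of
the quotient is that of the whole when the subcomplex is acyclic: a cycle of the
quotient lifts because its boundary is a cycle, hence a boundary, of Sub. *)
Lemma betti_acyclic_sub i b :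
  acyclic k Sub -> family_betti k Quo i b -> family_betti k Phi i b.
Proof.
move=> acy; have subI := subsetIl Phi D; have subD := subsetDl Phi D.
apply: (@family_betti_transfer _ _ _ _
  (fun v w => is_cycle Phi i v /\ w = restrict Quo v)).
- move=> v w [[cv bv] ->].
  have cw : is_chain Quo i (restrict Quo v) by apply: chain_restrict cv.
  split=> //; first by split=> //; rewrite -(restrict_quo_bdry cv) bv raddf0.
  split=> [[g cg ->]|[g cg rv]].
    exists (restrict Quo g); first by apply: chain_restrict cg.
    exact: restrict_quo_bdry cg.
  have cg' := chainS subD cg; have cbg := chain_bdry cg'.
  have cu : is_chain Sub i (v - bdry Phi g).
    apply: chain_sub; first exact: chainB.
    by rewrite raddfB /= (restrict_quo_bdry cg') (restrict_id cg) -rv subrr.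
  have [|a ca ua] := acy i (v - bdry Phi g).
    split=> //; rewrite -(bdry_sub cu) raddfB /= bv.
    by rewrite (bdryK cvx cg') subrr.
  exists (a + g); first by apply: chainD => //; apply: chainS ca.
  by rewrite raddfD /= (bdry_sub ca) -ua subrK.
- move=> a v w v' w' [zv ->] [zv' ->]; split; first exact: cycle_lin.
  by rewrite restrict_linear.
- by move=> v zv; exists (restrict Quo v).
move=> w [cw bw]; have cw' := chainS subD cw.
have [a ca aw] : exists2 a, is_chain Sub i a & bdry Phi w = bdry Sub a.
  (* Cardinality 0 is separate: the boundary would live in cardinality -1. *)
  case: i cw cw' => [|i] cw cw'.
    by exists 0; [apply: chain0 | rewrite raddf0 bdry_deg0].
  have cb : is_chain Sub i (bdry Phi w).
    apply: chain_sub; first exact: chain_bdry.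
    by rewrite (restrict_quo_bdry cw') (restrict_id cw).
  by apply: acy; split=> //; rewrite -(bdry_sub cb) (bdryK cvx cw').
exists (w - a); split.
  split; first by apply: chainB => //; apply: chainS ca.
  by rewrite raddfB /= (bdry_sub ca) aw subrr.
rewrite raddfB /= (restrict_id cw); apply/ffunP => F; rewrite !ffunE.
case: ifP => [|_]; last by rewrite subr0.
by rewrite in_setD => /andP[FD _];
  rewrite (chain_out ca) ?subr0 // in_setI (negPf FD) andbF.
Qed.

(** When the quotient is acyclic, every chain whose image in the quotient is a
cycle can be corrected by a boundary until it lies in the subcomplex; used for
cycles this gives surjectivity, for bounding chains injectivity. *)
Lemma betti_acyclic_quo i b :
  acyclic k Quo -> family_betti k Sub i b -> family_betti k Phi i b.
Proof.
move=> acy; have subI := subsetIl Phi D; have subD := subsetDl Phi D.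
have to_sub j (v : chain) : is_chain Phi j v -> bdry Quo (restrict Quo v) = 0 ->
    exists2 g, is_chain Phi j.+1 g & is_chain Sub j (v - bdry Phi g).
  move=> cv bv; have [|g cg rv] := acy j (restrict Quo v).
    by split=> //; apply: chain_restrict cv.
  have cg' := chainS subD cg; exists g => //; apply: chain_sub.
    by apply: chainB => //; apply: chain_bdry.
  by rewrite raddfB /= (restrict_quo_bdry cg') (restrict_id cg) rv subrr.
have subB (w : chain) : is_chain Sub i w -> is_boundary Phi i w ->
    is_boundary Sub i w.
  move=> cw [g cg wg]; have [|g' cg' ca] := to_sub _ _ cg.
    rewrite -(restrict_quo_bdry cg) -wg; apply/ffunP => F; rewrite !ffunE in_setD.
    case: ifP => // /andP[FD _].
    by rewrite (chain_out cw) // in_setI (negPf FD) andbF.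
  exists (g - bdry Phi g') => //.
  by rewrite -(bdry_sub ca) raddfB /= (bdryK cvx cg') subr0.
have Bsub (w : chain) : is_boundary Sub i w -> is_boundary Phi i w.
  by move=> [g cg ->]; exists g; [apply: chainS cg | rewrite (bdry_sub cg)].
apply: (@family_betti_transfer _ _ _ _ (fun v w =>
  [/\ is_cycle Phi i v, is_cycle Sub i w & is_boundary Phi i (v - w)])).
- move=> v w [zv zw Bvw]; split=> //; split=> [Bv|/Bsub Bw].
    by apply: subB; [case: zw | rewrite -(subKr v w); apply: boundaryB].
  by rewrite -(subrK w v) -[v - w]scale1r; apply: boundary_lin.
- move=> a v w v' w' [zv zw B1] [zv' zw' B2]; split; try exact: cycle_lin.
  by rewrite opprD addrACA -scalerBr; apply: boundary_lin.
- move=> v zv; have [cv bv] := zv; have [|g cg ca] := to_sub _ _ cv.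
    by rewrite -(restrict_quo_bdry cv) bv raddf0.
  exists (v - bdry Phi g); split=> //; last by rewrite subKr; exists g.
  by split=> //; rewrite -(bdry_sub ca) raddfB /= bv (bdryK cvx cg) subrr.
move=> w zw; have [cw bw] := zw; exists w; split=> //; last first.
  by rewrite subrr; apply: boundary0.
by split; [apply: chainS cw | rewrite (bdry_sub cw)].
Qed.

End Split.

(** * Families with a single non-acyclic fiber *)

Section Fibers.

Variables (k : fieldType) (N : nat).
Local Notation face := {set 'I_N}.
Local Notation family := {set {set 'I_N}}.
Local Notation chain := {ffun {set 'I_N} -> k^o}.
Implicit Types (Phi : family) (F G H W S : face).

Definition fiber Phi W S : family := [set F in Phi | F :&: W == S].

(** Deciding the vertices of W one after the other cuts the family repeatedly into
faces avoiding v (a subcomplex) and faces containing v (a quotient); at each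
cut the half that is not on the way to S0 has acyclic fibers only, hence is
acyclic. *)
Lemma betti_fiber W Phi S0 i b : convex Phi -> S0 \subset W ->
  (forall S, S \subset W -> S != S0 -> acyclic k (fiber Phi W S)) ->
  family_betti k (fiber Phi W S0) i b -> family_betti k Phi i b.
Proof.
elim: {W}_.+1 {-2}W (ltnSn #|W|) => // m IH W leWm in Phi S0 i b *.
have [->|/set0Pn[v vW]] := eqVneq W set0 => cvx.
  rewrite subset0 => /eqP-> _; congr (family_betti k _ i b).
  by apply/setP => F; rewrite !inE setI0 eqxx andbT.
pose W' := W :\ v; pose D : family := [set F : face | v \notin F].
have downD (F G : face) : F \subset G -> G \in D -> F \in D.
  by rewrite !inE => /subsetP FG; apply: contra; apply: FG.
have ltW' : (#|W'| < m)%N by move: leWm; rewrite (cardsD1 v W) vW.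
have vF (F S : face) : F :&: W = S -> (v \in F) = (v \in S).
  by move=> <-; rewrite inE vW andbT.
have fiberQ (S : face) : v \in S -> S \subset W ->
    fiber (Phi :\: D) W' (S :\ v) = fiber Phi W S.
  move=> vS SW; apply/setP => F; rewrite !inE negbK.
  case: (F \in Phi); rewrite ?andbF //= andbT.
  apply/andP/eqP => [[vF' /eqP FW]|FW]; last first.
    by rewrite (vF _ _ FW) vS /W' setIDA FW.
  apply/setP => x; have [->|xv] := eqVneq x v; first by rewrite !inE vF' vW vS.
  by move/setP/(_ x): FW; rewrite !inE xv.
have fiberS (S : face) : v \notin S -> S \subset W ->
    fiber (Phi :&: D) W' S = fiber Phi W S.
  move=> vS SW; apply/setP => F; rewrite !inE.
  case: (F \in Phi); rewrite ?andbF //=.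
  apply/andP/eqP => [[vF' /eqP FW]|FW]; last first.
    rewrite (vF _ _ FW) vS; split=> //; apply/eqP/setP => x.
    move/setP/(_ x): FW; rewrite !inE; case: eqVneq => //= ->.
    by rewrite andbF (negPf vS).
  apply/setP => x; have [->|xv] := eqVneq x v.
    by rewrite !inE (negPf vF') (negPf vS).
  by move/setP/(_ x): FW; rewrite !inE xv.
have fibQ (S : face) : S \subset W' -> 
    fiber (Phi :\: D) W' S = fiber Phi W (v |: S).
  move=> /subsetD1P[SW vS]; rewrite -fiberQ ?setU11 ?setU1K //.
  by rewrite subUset sub1set vW.
have IHQ := IH _ ltW' _ _ _ _ (convex_quo cvx downD).
have IHS := IH _ ltW' _ _ _ _ (convex_sub cvx downD).
move=> S0W acy betti0.
have [vS0|vS0] := boolP (v \in S0).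
  apply: (betti_acyclic_sub cvx downD); last first.
    apply: (IHQ (S0 :\ v)); rewrite ?fiberQ ?setSD // => S SW' SS0.
    rewrite fibQ //; case/subsetD1P: SW' => SW vS.
    apply: acy; first by rewrite subUset sub1set vW.
    by apply: contraNneq SS0 => <-; rewrite setU1K.
  apply/acyclicP => j; apply: (IHS set0); rewrite ?sub0set //.
    move=> S /subsetD1P[SW vS] _; rewrite fiberS //; apply: acy => //.
    by apply: contraNneq vS => ->.
  move: j; apply/acyclicP; rewrite fiberS ?sub0set ?inE //.
  by apply: acy; rewrite ?sub0set //; apply: contraTneq vS0 => <-; rewrite inE.
apply: (betti_acyclic_quo cvx downD); last first.
  apply: (IHS S0); rewrite ?fiberS //; first by apply/subsetD1P.
  by move=> S /subsetD1P[SW vS] SS0; rewrite fiberS //; apply: acy.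
apply/acyclicP => j; apply: (IHQ set0); rewrite ?sub0set //.
  move=> S SW' _; rewrite fibQ //; case/subsetD1P: SW' => SW vS.
  apply: acy; first by rewrite subUset sub1set vW.
  by apply: contraNneq vS0 => <-; rewrite setU11.
move: j; apply/acyclicP; rewrite fibQ ?sub0set // setU0.
by apply: acy; rewrite ?sub1set //; apply: contraNneq vS0 => <-; rewrite inE.
Qed.

Lemma betti_set1 (F0 : face) : family_betti k [set F0] #|F0| 1.
Proof.
pose e : chain := [ffun F : face => (F == F0)%:R].
have bdry0 j (f : chain) : is_chain [set F0] j f -> bdry [set F0] f = 0.
  move=> cf; apply/ffunP => G; rewrite !ffunE inE; case: eqP => // ->.
  rewrite big1 // => x xF0; rewrite (chain_out cf) ?scaler0 // inE.
  by apply: contraNneq xF0 => <-; rewrite setU11.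
have ce : is_chain [set F0] #|F0| e.
  by move=> F; rewrite ffunE inE; case: eqVneq => // ->; rewrite eqxx.
exists (fun=> e); split=> [_|v [cv _]]; first by split=> //; apply: bdry0 ce.
have vE : v = v F0 *: e.
  apply/ffunP => F; rewrite !ffunE; case: eqVneq => [->|FF0].
    by rewrite [RHS]mulr1.
  by rewrite scaler0 (chain_out cv) // inE.
exists [ffun=> v F0]; split.
  by rewrite big_ord1 ffunE -vE subrr; apply: boundary0.
move=> c [g /bdry0-> ]; rewrite big_ord1 => /eqP; rewrite subr_eq0 => /eqP vc.
by apply/ffunP => j; rewrite ord1 ffunE vc !ffunE eqxx [LHS]mulr1.
Qed.

End Fibers.

(** * Tor in a squarefree multidegree *)

Section SquarefreeTor.

Variables (k : fieldType) (N : nat).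
Local Notation face := {set 'I_N}.
Local Notation family := {set {set 'I_N}}.
Local Notation chain := {ffun {set 'I_N} -> k^o}.

Variables (L : {mpoly k[N]} -> Prop) (X : face) (Phi : family).
Hypothesis PhiX : forall F, F \in Phi -> F \subset X.
Hypothesis down : forall F G : face, F \subset G -> G \in Phi -> F \in Phi.
Hypothesis memL : forall (c : k) (F : face), F \subset X ->
  L (c *: 'X_[mesym1 (X :\: F)]) <-> c = 0 \/ F \in Phi.

Lemma mesym1_subsetP (F : face) (m : 'X_{1..N}) :
  (m + mesym1 F)%MM = mesym1 X <-> F \subset X /\ m = mesym1 (X :\: F).
Proof.
split=> [mF|[/subsetP FX ->]]; last first.
  apply/mnmP => y; rewrite mnmDE !mnmE !inE.
  by case: (boolP (y \in F)) => [/FX->|]; rewrite ?addn0.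
have mFE y : (m y + (y \in F) = (y \in X))%N.
  by have := congr1 (fun h : 'X_{1..N} => h y) mF; rewrite mnmDE !mnmE.
split.
  apply/subsetP => y yF; have := mFE y; rewrite yF.
  by case: (y \in X) => //; rewrite addn1.
apply/mnmP => y; rewrite mnmE !inE; have := mFE y.
by case: (y \in F); case: (y \in X); rewrite ?addn0 ?addn1 //= => -[].
Qed.

(** The multidegree forces the coefficient at F to be a multiple of x^(X \ F), and
to vanish unless F is contained in X. *)
Lemma koszul_chain_monomial i f : koszul_chain L i (mesym1 X) f <->
  exists2 c : chain, is_chain Phi i c & f = monomial_chain X c.
Proof.
split=> [[Lf f0 fa]|[c cc ->]].
  pose c : chain := [ffun F : face =>
    if F \subset X then (f F)@_(mesym1 (X :\: F)) else 0].
  have fE : f = monomial_chain X c.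
    apply/ffunP => F; rewrite !ffunE; apply/mpolyP => m; rewrite mcoeffZ mcoeffX.
    have [mf|mf] := boolP (m \in msupp (f F)).
      have /mesym1_subsetP[-> mE] := fa _ _ mf.
      by rewrite -mE eqxx mulr1.
    rewrite (memN_msupp_eq0 mf); case: eqP => [E|]; last by rewrite mulr0.
    by rewrite E (memN_msupp_eq0 mf) if_same mul0r.
  exists c => // F; rewrite negb_and => /orP[FPhi|/f0 f0F]; last first.
    by rewrite ffunE f0F mcoeff0 if_same.
  have [FX|FX] := boolP (F \subset X); last by rewrite ffunE (negPf FX).
  have := Lf F; rewrite {1}fE ffunE => /(memL _ FX)[//|].
  by rewrite (negPf FPhi).
have L0 : L 0.
  by have /memL-/(_ 0)[_ /(_ (or_introl erefl))] := sub0set X; rewrite scale0r.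
split=> F; rewrite ffunE.
- have [FPhi|FPhi] := boolP (F \in Phi); last by rewrite (chain_out cc FPhi) scale0r.
  by apply/memL; [exact: PhiX | right].
- by move=> Fi; rewrite cc ?scale0r // negb_and Fi orbT.
move=> m; have [FPhi|FPhi] := boolP (F \in Phi); last first.
  by rewrite (chain_out cc FPhi) scale0r msupp0.
move=> /msuppZ_le; rewrite msuppX inE => /eqP->.
by apply/mesym1_subsetP; split=> //; apply: PhiX.
Qed.

Lemma koszul_diff_chain i (c : chain) : is_chain Phi i c ->
  koszul_diff (monomial_chain X c) = monomial_chain X (bdry Phi c).
Proof.
move=> cc; rewrite diff_monomial_chain; last first.
  by move=> F FX; rewrite (chain_out cc) //; apply: contra FX; apply: PhiX.
congr monomial_chain; apply/ffunP => G; rewrite [RHS]ffunE.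
case: ifPn => // GPhi; rewrite ffunE big1 // => x _.
rewrite (chain_out cc) ?scaler0 //; apply: contra GPhi.
by apply: down; apply: subsetUr.
Qed.

Fact monomial_chain_linear : linear (@monomial_chain k N X).
Proof.
move=> a f g; apply/ffunP => F; rewrite !ffunE scalerDl; congr (_ + _).
by rewrite [RHS]scalerA.
Qed.

Lemma monomial_chain_inj : injective (@monomial_chain k N X).
Proof.
move=> f g fg; apply/eqP; rewrite -subr_eq0; apply/eqP.
apply: (@monomial_chain_eq0 _ _ X).
by rewrite addrC -scaleN1r monomial_chain_linear fg scaleN1r addNr.
Qed.

Lemma Tor_dim_family i b : family_betti k Phi i b -> Tor_dim L i (mesym1 X) b.
Proof.
apply: (@subquotient_dim_rel _ _ _ _ _ _ _
  (fun f c => f = monomial_chain X c /\ is_cycle Phi i c)).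
- move=> f c [-> [cc bc]]; split=> //.
    split; first by apply/koszul_chain_monomial; exists c.
    rewrite (koszul_diff_chain cc) bc; apply/ffunP => F.
    by rewrite !ffunE scale0r.
  split=> [[g /koszul_chain_monomial[e ce ->]]|[e ce ->]].
    by rewrite (koszul_diff_chain ce) => /monomial_chain_inj->; exists e.
  exists (monomial_chain X e); first by apply/koszul_chain_monomial; exists e.
  by rewrite (koszul_diff_chain ce).
- move=> a f c f' c' [-> zc] [-> zc']; split; last exact: cycle_lin.
  by rewrite monomial_chain_linear.
- move=> f [/koszul_chain_monomial[c cc ->] bf]; exists c; split=> //; split=> //.
  by apply: (@monomial_chain_eq0 _ _ X); rewrite -(koszul_diff_chain cc).
by move=> c zc; exists (monomial_chain X c).
Qed.

End SquarefreeTor.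

(** * Collapsing the levels *)

Section Matching.

Variables (k : fieldType) (N : nat).
Local Notation face := {set 'I_N}.
Local Notation family := {set {set 'I_N}}.
Variables (lev : 'I_N -> nat) (le : rel 'I_N) (X M : face).
Implicit Types (F G H S W : face).

(** [reach G j x]: x is the top of a multichain in G that meets the levels
0, .., j. *)
Fixpoint reach G j x : bool :=
  [&& x \in G, lev x == j
    & if j is j'.+1 then [exists y, reach G j' y && le y x] else true].

(** Above level j the face is forced to be the complement of M, where M stands for
the minimal elements of the levels; below, the complement of the face must
contain a multichain.  The top value of j gives the complex of interest, and
lowering j by one is one round of the collapse. *)
Definition multichain_family j : family :=
  [set F : face | [&& F \subset X,
     [forall x in X, (j < lev x)%N ==> ((x \in F) == (x \notin M))]
   & [exists x, reach (X :\: F) j x]]].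

Lemma multichain_familyP j F : reflect
  [/\ F \subset X,
      forall x, x \in X -> (j < lev x)%N -> (x \in F) = (x \notin M)
    & exists x, reach (X :\: F) j x]
  (F \in multichain_family j).
Proof.
rewrite inE; apply: (iffP and3P) => [[-> fixF /existsP ex]|[-> fixF ex]].
  by split=> // x xX lt; move/forall_inP/(_ x xX)/implyP/(_ lt)/eqP: fixF.
split=> //; last exact/existsP.
by apply/forall_inP => x xX; apply/implyP => lt; rewrite fixF.
Qed.

Lemma reach_in G j x : reach G j x -> x \in G.
Proof. by case: j => [|j] /and3P[]. Qed.

Lemma reach_lev G j x : reach G j x -> lev x = j.
Proof. by case: j => [|j] /and3P[_ /eqP]. Qed.

(** At level j only the endpoint x matters, which is what makes its rivals on the
same level free to be toggled. *)
Lemma reach_sub G H j x :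
  (forall y, (lev y < j)%N -> y \in G -> y \in H) -> x \in H ->
  reach G j x -> reach H j x.
Proof.
elim: j x => [|j IH] x sub xH /and3P[_ lx]; rewrite /= xH lx //=.
case/existsP=> y /andP[ry yx]; apply/existsP; exists y; rewrite yx andbT.
have ly : (lev y < j.+1)%N by rewrite (reach_lev ry).
by apply: IH (ry); [move=> z zj; apply: sub; apply: ltnW | apply: sub (reach_in ry)].
Qed.

Lemma reachS G H j x : G \subset H -> reach G j x -> reach H j x.
Proof.
move=> /subsetP GH r; apply: reach_sub (r); last by apply: GH; apply: reach_in r.
by move=> y _; apply: GH.
Qed.

Lemma convex_multichain_family j : convex (multichain_family j).
Proof.
move=> F G H FG GH /multichain_familyP[_ fF _] /multichain_familyP[HX fH [x rx]].
apply/multichain_familyP; split; first exact: subset_trans HX.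
  move=> y yX lt; apply/idP/idP => [/(subsetP GH)|].
    by rewrite fH.
  by move=> yM; apply: (subsetP FG); rewrite fF.
by exists x; apply: reachS rx; apply: setDS.
Qed.

Lemma convex_fiber (Phi : family) W S : convex Phi -> convex (fiber Phi W S).
Proof.
move=> cvx F G H FG GH; rewrite !inE => /andP[FPhi /eqP FW] /andP[HPhi /eqP HW].
rewrite (cvx F G H) //= eqEsubset -{2}FW -{1}HW.
by rewrite !setSI.
Qed.

Hypothesis le_tr : transitive le.
Hypothesis MX : M \subset X.

Section Step.

Variable j : nat.
Hypothesis above : forall x, x \in X -> lev x = j.+1 ->
  exists m, [/\ m \in M, lev m = j.+1 & le m x].
Hypothesis private : forall m, m \in M -> lev m = j.+1 ->
  exists b, [/\ b \in X, lev b = j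
    & forall y, y \in M -> lev y = j.+1 -> le b y -> y = m].
Hypothesis dominated : forall x, x \in X -> lev x = j ->
  exists m, [/\ m \in M, lev m = j.+1 & le x m].

(** One level is collapsed in two rounds.  W1, the elements of level j+1 outside M,
is decided first: a face missing some n in W1 allows an m in M below n to be
toggled.  On the faces containing W1 the set W2 = M at level j+1 is decided: a
face containing some m in W2 allows the element b of [private] to be toggled,
since the only element of M above b at that level is no longer available.  The faces that
contain W1 and avoid W2 are those of the family for j. *)
Lemma betti_multichain_family_step i b :
  family_betti k (multichain_family j) i b ->
  family_betti k (multichain_family j.+1) i b.
Proof.
pose W1 : face := [set x in X | (lev x == j.+1) && (x \notin M)].
pose W2 : face := [set x in M | lev x == j.+1].
move=> IH; apply: (@betti_fiber _ _ W1 _ W1) => //.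
- exact: convex_multichain_family.
- move=> S SW1 SneW1.
  have [n nW1 nS] : exists2 n, n \in W1 & n \notin S.
    by apply/subsetPn; apply: contraNN SneW1 => W1S; rewrite eqEsubset SW1.
  have [nX ln] : n \in X /\ lev n = j.+1 by case/setIdP: nW1 => -> /andP[/eqP].
  have [m [mM lm lemn]] := above nX ln; have mX := subsetP MX m mM.
  have mW1 : m \notin W1 by rewrite inE mM !andbF.
  apply: (@acyclic_toggle _ _ _ m) => F mF; rewrite ![_ \in fiber _ _ _]inE.
  have -> : (m |: F) :&: W1 = F :&: W1.
    apply/setP => x; rewrite !inE; case: eqVneq => //= ->.
    by rewrite mM !andbF.
  have [FW1|] := eqVneq (F :&: W1) S; rewrite ?andbF // !andbT.
  have nF : n \in X :\: F.
    by rewrite inE nX andbT; apply: contra nS => nF; rewrite -FW1 inE nF.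
  (* A multichain ending in m is rerouted to end in n. *)
  have mn : m != n by apply: contraNneq mW1 => ->.
  apply/multichain_familyP/multichain_familyP => [[FX fF [x rx]]|[FX fF [x rx]]].
    split; first by apply: subset_trans FX; apply: subsetUr.
      move=> x' x'X lt; rewrite -fF // !inE; case: eqVneq => // E.
      by move: lt; rewrite E lm ltnn.
    by exists x; apply: reachS rx; apply: setDS; apply: subsetUr.
  split; first by rewrite subUset sub1set mX.
    move=> x' x'X lt; rewrite -fF // !inE; case: eqVneq => // E.
    by move: lt; rewrite E lm ltnn.
  have low y : (lev y < j.+1)%N -> y \in X :\: F -> y \in X :\: (m |: F).
    move=> ly; rewrite !inE negb_or => /andP[-> ->]; rewrite !andbT.
    by apply: contraTneq ly => ->; rewrite lm ltnn.
  have [xm|xm] := eqVneq x m; last first.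
    exists x; apply: reach_sub (rx) => //.
    by have := reach_in rx; rewrite !inE negb_or xm.
  move: rx; rewrite xm => /and3P[_ _ /existsP[y /andP[ry yx]]].
  exists n; rewrite /= ln eqxx; apply/andP; split.
    by move: nF; rewrite !inE negb_or eq_sym mn.
  apply/existsP; exists y; rewrite (le_tr yx) // andbT.
  apply: reach_sub (ry); first by move=> z /ltnW; apply: low.
  by apply: low (reach_in ry); rewrite (reach_lev ry).
have W12 F x : F :&: W1 = W1 -> F :&: W2 = set0 -> x \in X -> lev x = j.+1 ->
    (x \in F) = (x \notin M).
  move=> FW1 FW2 xX lx; have [xM|xM] := boolP (x \in M).
    by move/setP/(_ x): FW2; rewrite !inE xM lx eqxx /= andbT.
  by move/setP/(_ x): FW1; rewrite !inE xX xM lx eqxx /= andbT.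
apply: (@betti_fiber _ _ W2 _ set0); rewrite ?sub0set //.
- by apply: convex_fiber; apply: convex_multichain_family.
- move=> S SW2 /set0Pn[m mS]; have /setIdP[mM /eqP lm] := subsetP SW2 m mS.
  have [p [pX lp onlym]] := private mM lm.
  apply: (@acyclic_toggle _ _ _ p) => F pF; rewrite ![_ \in fiber _ _ _]inE.
  have pW W' : (forall x, x \in W' -> lev x = j.+1) -> (p |: F) :&: W' = F :&: W'.
    move=> lW'; apply/setP => x; rewrite !inE; case: eqVneq => //= ->.
    by rewrite (negPf pF); apply/negP => /lW'; rewrite lp => /n_Sn.
  rewrite !pW; try by move=> x /setIdP[_ /andP[/eqP]].
  2: by move=> x /setIdP[_ /eqP].
  have [FW1|] := eqVneq (F :&: W1) W1; rewrite ?andbF // !andbT.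
  have [FW2|] := eqVneq (F :&: W2) S; rewrite ?andbF // !andbT.
  apply/multichain_familyP/multichain_familyP => [[FX fF [x rx]]|[FX fF [x rx]]].
    split; first by apply: subset_trans FX; apply: subsetUr.
      move=> x' x'X lt; rewrite -fF // !inE; case: eqVneq => // E.
      by move: lt; rewrite E lp ltnNge leqnSn.
    by exists x; apply: reachS rx; apply: setDS; apply: subsetUr.
  split; first by rewrite subUset sub1set pX.
    move=> x' x'X lt; rewrite -fF // !inE; case: eqVneq => // E.
    by move: lt; rewrite E lp ltnNge leqnSn.
  exists x; have xG := reach_in rx; have lx := reach_lev rx.
  have /setDP[xX xF] := xG.
  have xM : x \in M.
    by apply: contraNT xF => xM; move/setP/(_ x): FW1;
      rewrite !inE xX xM lx eqxx /= andbT.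
  have xm : x != m.
    apply: contraNneq xF => ->; move: mS; rewrite -FW2 inE; by case/andP.
  (* The multichain ends in some x in M other than m, so it avoids p. *)
  have px : ~~ le p x by apply: contra xm => /onlym->.
  have neqp z : z != p -> z \in X :\: F -> z \in X :\: (p |: F).
    by move=> zp; rewrite !inE negb_or zp.
  have xp : x != p by apply: contra_eq_neq lx => ->; rewrite lp neq_ltn ltnSn.
  move: rx => /and3P[_ _ /existsP[y /andP[ry yx]]].
  rewrite /= lx eqxx neqp //=; apply/existsP; exists y; rewrite yx andbT.
  apply: reach_sub (ry); last first.
    by apply: neqp (reach_in ry); apply: contraTneq yx => ->.
  by move=> z lz; apply: neqp; apply: contraTneq lz => ->; rewrite lp ltnn.
congr (family_betti k _ i b) : IH; apply/setP => F; rewrite ![_ \in fiber _ _ _]inE.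
apply/multichain_familyP/andP =>
  [[FX fF [x rx]]|[/andP[/multichain_familyP[FX fF [x rx]]]]].
  have fFj y : y \in X -> lev y = j.+1 -> (y \in F) = (y \notin M).
    by move=> yX ly; apply: fF => //; rewrite ly.
  split; last first.
    apply/eqP/setP => y; rewrite !inE; apply/negP => /andP[yF /andP[yM /eqP ly]].
    by have := fFj y (subsetP MX _ yM) ly; rewrite yF yM.
  apply/andP; split; last first.
    apply/eqP/setP => y; rewrite inE andbC.
    case: (boolP (y \in W1)) => // /setIdP[yX].
    by case/andP=> /eqP ly yM; rewrite fFj.
  apply/multichain_familyP; split=> //; first by move=> y yX /ltnW; apply: fF.
  have /setDP[xX xF] := reach_in rx.
  have [m [mM lm xm]] := dominated xX (reach_lev rx).
  have mX := subsetP MX m mM.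
  exists m; rewrite /= lm eqxx inE mX fFj // mM /=.
  by apply/existsP; exists x; rewrite rx.
move=> /eqP FW1 /eqP FW2; split=> //.
  move=> y yX; rewrite leq_eqVlt => /orP[/eqP/esym ly|]; last exact: fF.
  exact: W12.
by case/and3P: rx => _ _ /existsP[y /andP[ry _]]; exists y.
Qed.

End Step.

Variable x0 : 'I_N.
Hypothesis x0X : x0 \in X.
Hypothesis lev0 : lev x0 = 0%N.

(** The face that remains after all levels above 0 are forced and level 0 is
collapsed by toggling x0. *)
Definition critical_face : face := X :\: (x0 |: [set x in M | (0 < lev x)%N]).

(** A face of the lowest family misses some vertex of level 0.  If it misses a
vertex other than x0 then x0 is free; the only other face misses x0 alone. *)
Lemma betti_multichain_family0 :
  family_betti k (multichain_family 0) #|critical_face| 1.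
Proof.
pose W : face := [set x in X | (lev x == 0%N) && (x != x0)].
apply: (@betti_fiber _ _ W _ W) => //; first exact: convex_multichain_family.
  move=> S SW SneW.
  have [n nW nS] : exists2 n, n \in W & n \notin S.
    by apply/subsetPn; apply: contraNN SneW => WS; rewrite eqEsubset SW.
  have /setIdP[nX /andP[ln nx0]] := nW.
  apply: (@acyclic_toggle _ _ _ x0) => F x0F; rewrite ![_ \in fiber _ _ _]inE.
  have -> : (x0 |: F) :&: W = F :&: W.
    by apply/setP => x; rewrite !inE; case: eqVneq => //=; rewrite !andbF.
  have [FW|] := eqVneq (F :&: W) S; rewrite ?andbF // !andbT.
  have nF : n \notin F by apply: contra nS => nF; rewrite -FW inE nF.
  apply/multichain_familyP/multichain_familyP => [[FX fF _]|[FX fF _]].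
    split; first by apply: subset_trans FX; apply: subsetUr.
      move=> x xX lt; rewrite -fF // !inE; case: eqVneq => // E.
      by move: lt; rewrite E lev0.
    by exists n; rewrite /= inE nX nF ln.
  split; first by rewrite subUset sub1set x0X.
    move=> x xX lt; rewrite -fF // !inE; case: eqVneq => // E.
    by move: lt; rewrite E lev0.
  by exists n; rewrite /= !inE negb_or nX nF ln nx0.
suff -> : fiber (multichain_family 0) W W = [set critical_face] by apply: betti_set1.
apply/setP => F; rewrite [_ \in fiber _ _ _]inE [RHS]inE.
apply/andP/eqP => [[/multichain_familyP[FX fF [x]]]|->].
  rewrite /= andbT => /andP[/setDP[xX xF] lx] /eqP FW.
  have FWE y : y \in X -> lev y = 0%N -> y != x0 -> y \in F.
    by move=> yX ly yx0; move/setP/(_ y): FW; rewrite !inE yX ly yx0 !andbT.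
  have x0F : x0 \notin F.
    by apply: contra xF => x0F; case: (eqVneq x x0) => [->//|];
      apply: FWE; last exact/eqP.
  apply/setP => y; rewrite !inE negb_or negb_and.
  have [yX|yX] := boolP (y \in X); last first.
    by rewrite andbF; apply: contraNF yX => /(subsetP FX).
  rewrite andbT; have [->|yx0] := eqVneq y x0; first exact: negPf.
  have [ly|ly] := posnP (lev y); first by rewrite orbT FWE.
  by rewrite fF // orbF.
split.
  apply/multichain_familyP; split; first exact: subsetDl.
    move=> x xX lt; rewrite !inE xX lt !andbT negb_or andb_idl // => _.
    by apply: contraTneq lt => ->; rewrite lev0.
  by exists x0; rewrite /= lev0 !inE x0X !eqxx.
apply/eqP/setP => x; rewrite !inE negb_or.
by case: (boolP (x \in X)) => // _; case: eqVneq => _; case: (lev x) => [|l];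
   rewrite ?andbF //= andbT.
Qed.

Lemma betti_multichain_family t :
  (forall j, (j < t)%N ->
    [/\ forall x, x \in X -> lev x = j.+1 ->
          exists m, [/\ m \in M, lev m = j.+1 & le m x],
        forall m, m \in M -> lev m = j.+1 ->
          exists b, [/\ b \in X, lev b = j
            & forall y, y \in M -> lev y = j.+1 -> le b y -> y = m]
      & forall x, x \in X -> lev x = j ->
          exists m, [/\ m \in M, lev m = j.+1 & le x m]]) ->
  family_betti k (multichain_family t) #|critical_face| 1.
Proof.
elim: t => [|t IH] hyp; first exact: betti_multichain_family0.
have [above private dominated] := hyp t (ltnSn t).
apply: betti_multichain_family_step => //.
by apply: IH => j jt; apply: hyp; apply: ltnW.
Qed.

End Matching.

(** * Extremal elements *)

Section Elements.

Variables (d : Order.disp_t) (P : finPOrderType d).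
Implicit Types (A : {set P}) (p q : P).

Lemma exists_min_below A p : p \in A -> exists2 q, q \in min_elts A & (q <= p)%O.
Proof.
move=> pA; pose below q := [set r in A | (r <= q)%O].
(* An element with fewest elements of A below it is minimal. *)
case: (@arg_minnP P p (fun q => (q \in A) && (q <= p)%O) (fun q => #|below q|)).
  by rewrite pA lexx.
move=> q /andP[qA qp] minq.
exists q => //; rewrite inE qA; apply/forall_inP => r rA; apply/implyP => rq.
have := minq r; rewrite rA (le_trans rq qp) => /(_ isT) leqr.
have /eqP bqr : below r == below q.
  rewrite eqEcard leqr andbT; apply/subsetP => z; rewrite !inE => /andP[-> zr].
  exact: le_trans rq.
have : q \in below r by rewrite bqr inE qA lexx.
by rewrite inE eq_le rq => /andP[].
Qed.

Lemma min_eltsS A : min_elts A \subset A.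
Proof. by apply/subsetP => p /setIdP[]. Qed.

Lemma max_eltsS A : max_elts A \subset A.
Proof. by apply/subsetP => p /setIdP[]. Qed.

End Elements.

Lemma exists_max_above (d : Order.disp_t) (P : finPOrderType d) (A : {set P}) p :
  p \in A -> exists2 q, q \in max_elts A & (p <= q)%O.
Proof. exact: (@exists_min_below _ P^d A). Qed.

(** * Letterplace monomials *)

Section Letterplace.

Variables (k : fieldType) (d : Order.disp_t) (P : finPOrderType d) (n : nat).
Local Notation N := #|{: 'I_n * P}|.
Local Notation face := {set 'I_N}.
Local Notation var := (@lpvar d P n).
Implicit Types (R : 'I_n -> {set P}) (F G : face).

Definition level (x : 'I_N) : nat := (enum_val x).1.
Definition letter (x : 'I_N) : P := (enum_val x).2.
Definition letter_le (x y : 'I_N) : bool := (letter x <= letter y)%O.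
Definition variables R : face := var @: graph_set R.

Lemma lpvar_inj : injective var. Proof. exact: enum_rank_inj. Qed.

Lemma level_var i p : level (var (i, p)) = i.
Proof. by rewrite /level /lpvar enum_rankK. Qed.

Lemma letter_var i p : letter (var (i, p)) = p.
Proof. by rewrite /letter /lpvar enum_rankK. Qed.

Lemma mem_variables R i p : (var (i, p) \in variables R) = (p \in R i).
Proof. by rewrite mem_imset ?inE //; apply: lpvar_inj. Qed.

Lemma varP (x : 'I_N) : exists i p, x = var (i, p).
Proof.
exists (enum_val x).1, (enum_val x).2.
by rewrite /lpvar -surjective_pairing enum_valK.
Qed.

Lemma card_variables R : #|variables R| = (\sum_i #|R i|)%N.
Proof.
rewrite card_imset; last exact: lpvar_inj.
rewrite -sum1_card (eq_bigl (fun x => xpredT x.1 && (x.2 \in R x.1))).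
  by rewrite -(pair_big_dep xpredT (fun i p => p \in R i) (fun _ _ => 1%N));
     apply: eq_bigr => i _; rewrite sum1_card.
by move=> x; rewrite inE.
Qed.

Lemma letterplace_monomial (u : {ffun 'I_n -> P}) :
  \prod_(i < n) 'X_(var (i, u i))
  = 'X_[mesym1 [set var (i, u i) | i : 'I_n]] :> {mpoly k[N]}.
Proof.
rewrite mprodXE; congr 'X_[_]; apply/mnmP => y; rewrite mnm_sumE mnmE.
have [i0 [p ->]] := varP y; rewrite (bigD1 i0) //= big1 ?addn0 => [|i ii0].
  rewrite mnm1E (inj_eq lpvar_inj) xpair_eqE eqxx /=.
  congr nat_of_bool; apply/eqP/imsetP => [<-|[i _ /lpvar_inj[-> ->]] //].
  by exists i0.
by rewrite mnm1E (inj_eq lpvar_inj) xpair_eqE (negPf ii0).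
Qed.

Lemma letterplace_idealP (c : k) (G : face) :
  letterplace_ideal (c *: 'X_[mesym1 G] : {mpoly k[N]}) <->
  c = 0 \/ exists u : {ffun 'I_n -> P},
    multichain u /\ forall i, var (i, u i) \in G.
Proof.
split=> [[g gE]|[->|[u [mu uG]]]].
- have [->|c0] := eqVneq c 0; [by left | right].
  have : mesym1 G \in
      msupp (\sum_(u | multichain u) g u * \prod_(i < n) 'X_(var (i, u i))).
    by rewrite -gE msuppMCX // inE.
  move=> /msupp_sum_le/flatten_mapP[u]; rewrite mem_filter => /andP[mu _].
  rewrite letterplace_monomial mulrC => /msuppM_le/allpairsP[[m1 m2] /= []].
  rewrite msuppX inE => /eqP-> _ GE; exists u; split=> // i.
  have := congr1 (fun h : 'X_{1..N} => h (var (i, u i))) GE.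
  rewrite mnmDE !mnmE (imset_f (fun i => var (i, u i))) //=.
  by case: (_ \in G).
- by exists (fun=> 0); rewrite big1 ?scale0r // => u _; rewrite mul0r.
pose U := [set var (i, u i) | i : 'I_n].
exists (fun v => if v == u then c *: 'X_[mesym1 (G :\: U)] else 0).
rewrite (bigD1 u) //= eqxx letterplace_monomial big1 ?addr0; last first.
  by move=> v /andP[_ /negPf->]; rewrite mul0r.
rewrite -scalerAl -mpolyXD; congr (_ *: 'X_[_]).
symmetry; apply/mesym1_subsetP; split=> //.
by apply/subsetP => _ /imsetP[i _ ->].
Qed.

End Letterplace.

(** * Multichains as functions *)

Section Multichains.

Variables (d : Order.disp_t) (P : finPOrderType d) (t : nat).
Local Notation n := t.+1.
Local Notation N := #|{: 'I_n * P}|.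
Local Notation face := {set 'I_N}.
Local Notation var := (@lpvar d P n).
Local Notation reach := (reach (@level d P n) (@letter_le d P n)).

Lemma reach_multichain (G : face) x : reach G t x ->
  exists u : {ffun 'I_n -> P}, multichain u /\ forall i, var (i, u i) \in G.
Proof.
have path j y : reach G j y -> exists u : nat -> P,
    [/\ u j = letter y, forall i : 'I_n, (i <= j)%N -> var (i, u i) \in G
      & forall a b, (a <= b <= j)%N -> (u a <= u b)%O].
  elim: j y => [|j IH] y.
    have [i [p ->]] := varP y; rewrite /= level_var andbT => /andP[yG /eqP i0].
    exists (fun=> p); split=> //; first by rewrite letter_var.
    move=> i'; rewrite leqn0 => /eqP i'0.
    by rewrite (_ : i' = i) //; apply: val_inj; rewrite /= i0.
  have [i [p ->]] := varP y; rewrite /= level_var /letter_le letter_var.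
  case/and3P=> yG /eqP ij /existsP[z /andP[/IH[u [uj uG umono]] zp]].
  exists (fun a => if (a <= j)%N then u a else p); split; first by rewrite ltnn.
    move=> i'; case: ifP => [ltj _|nlt lei]; first exact: uG.
    rewrite (_ : i' = i) //; apply: val_inj; apply/eqP; rewrite /= ij.
    by rewrite eqn_leq lei ltnNge nlt.
  move=> a b /andP[ab bj]; case: ifP => aj; case: ifP => bj'.
  - by apply: umono; rewrite ab.
  - by apply: le_trans zp; rewrite -uj; apply: umono; rewrite aj leqnn.
  - by move: aj; rewrite (leq_trans ab).
  - by [].
case/path=> u [_ uG umono]; exists [ffun i : 'I_n => u i]; split; last first.
  by move=> i; rewrite ffunE; apply: uG; rewrite -ltnS.
apply/forallP => i; apply/forallP => j; apply/implyP => ij; rewrite !ffunE.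
by apply: umono; rewrite ij -ltnS ltn_ord.
Qed.

Lemma multichain_reach (G : face) (u : {ffun 'I_n -> P}) :
  multichain u -> (forall i, var (i, u i) \in G) -> exists x, reach G t x.
Proof.
move=> mu uG.
have path j : (j <= t)%N -> reach G j (var (inord j, u (inord j))).
  elim: j => [|j IH] jt; rewrite /= uG level_var inordK ?eqxx //=.
  apply/existsP; exists (var (inord j, u (inord j))); rewrite IH 1?ltnW //=.
  rewrite /letter_le !letter_var.
  move/forallP/(_ (inord j))/forallP/(_ (inord j.+1))/implyP: mu; apply.
  by rewrite !inordK // ltnW.
by eexists; apply: path (leqnn t).
Qed.

End Multichains.

(** * The last linear strand *)

Section MainProof.

Variables (d : Order.disp_t) (P : finPOrderType d) (k : fieldType) (t : nat).
Local Notation n := t.+1.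
Variable R : 'I_n -> {set P}.
Hypothesis R_nonempty : forall j, R j != set0.
Hypothesis R_step : forall j j' : 'I_n, nat_of_ord j' = (nat_of_ord j).+1 ->
  [/\ set_le (R j) (R j'),
      #|max_elts (R j)| = width P,
      #|min_elts (R j')| = width P
    & comparability_matching (max_elts (R j)) (min_elts (R j'))].

Local Notation N := #|{: 'I_n * P}|.
Local Notation face := {set 'I_N}.
Local Notation var := (@lpvar d P n).
Local Notation X := (variables R).
Local Notation M := (variables (fun i => min_elts (R i))).
Local Notation lev := (@level d P n).
Local Notation lle := (@letter_le d P n).

(** For m = phi a in min(R_(j+1)), the private element is its partner a in max(R_j):
an element of min(R_(j+1)) above a is comparable to a, hence equals phi a. *)
Lemma letterplace_steps j : (j < t)%N ->
  [/\ forall x, x \in X -> lev x = j.+1 ->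
        exists m, [/\ m \in M, lev m = j.+1 & lle m x],
      forall m, m \in M -> lev m = j.+1 ->
        exists b, [/\ b \in X, lev b = j
          & forall y, y \in M -> lev y = j.+1 -> lle b y -> y = m]
    & forall x, x \in X -> lev x = j ->
        exists m, [/\ m \in M, lev m = j.+1 & lle x m]].
Proof.
move=> jt; pose J : 'I_n := inord j; pose J' : 'I_n := inord j.+1.
have JE : J = j :> nat by rewrite inordK // ltnW.
have J'E : J' = j.+1 :> nat by rewrite inordK.
have [|[maxmin _] _ _ [phi [_ phi_onto phiP]]] := R_step (j := J) (j' := J').
  by rewrite JE J'E.
have levJ i p : lev (var (i, p)) = j -> i = J.
  by rewrite level_var => ij; apply: val_inj; rewrite /= JE.
have levJ' i p : lev (var (i, p)) = j.+1 -> i = J'.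
  by rewrite level_var => ij; apply: val_inj; rewrite /= J'E.
split=> x; have [i [p ->]] := varP x; rewrite mem_variables => pR.
- move=> /levJ' iJ; rewrite {i}iJ in pR *.
  have [q qmin qp] := exists_min_below pR; exists (var (J', q)).
  by rewrite mem_variables level_var /letter_le !letter_var.
- move=> /levJ' iJ; rewrite {i}iJ in pR *.
  move: (pR); rewrite -phi_onto => /imsetP[a amax pE].
  exists (var (J, a)); split.
  + by rewrite mem_variables (subsetP (max_eltsS _) _ amax).
  + by rewrite level_var.
  move=> y; have [i [q ->]] := varP y.
  rewrite mem_variables => + /levJ' iJ; rewrite {}iJ /letter_le !letter_var => qmin aq.
  by rewrite pE ((phiP a q amax qmin).1 (le_comparable aq)).
move=> /levJ iJ; rewrite {i}iJ in pR *.
have [a amax pa] := exists_max_above pR; have [b bmin ab] := maxmin a amax.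
exists (var (J', b)).
by rewrite mem_variables level_var /letter_le !letter_var (le_trans pa).
Qed.

Lemma critical_face_card (x0 : 'I_N) : x0 \in X -> lev x0 = 0%N ->
  (#|critical_face lev X M x0| + (width P * t + 1) = #|X|)%N.
Proof.
move=> x0X lev0; rewrite /critical_face.
pose T (i : 'I_n) := if (0 < i)%N then min_elts (R i) else set0.
have -> : [set x in M | (0 < lev x)%N] = variables T.
  apply/setP => x; have [i [p ->]] := varP x.
  rewrite inE !mem_variables level_var /T; case: ifP => _; first by rewrite andbT.
  by rewrite andbF inE.
have cardT : #|variables T| = (width P * t)%N.
  rewrite card_variables big_ord_recl /T /= cards0 add0n.
  rewrite (eq_bigr (fun=> width P)) => [|i _].
    by rewrite sum_nat_const card_ord mulnC.
  by case: (R_step (j := widen_ord (leqnSn t) i) (j' := lift ord0 i)).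
have x0T : x0 \notin variables T.
  have [i [p E]] := varP x0; move: lev0; rewrite E level_var mem_variables /T => ->.
  by rewrite inE.
have sub : x0 |: variables T \subset X.
  rewrite subUset sub1set x0X; apply/subsetP => x; have [i [p ->]] := varP x.
  rewrite !mem_variables /T; case: ifP => _; last by rewrite inE.
  exact: subsetP (min_eltsS _) p.
rewrite -(cardsID (x0 |: variables T) X) (setIidPr sub) cardsU1 x0T cardT.
by rewrite addnC [(1 + _)%N]addnC.
Qed.

Lemma letterplace_last_strand :
  exists2 i, (i + (width P * t + 1) = #|graph_set R|)%N & betti k i (graph_set R) 1.
Proof.
have /set0Pn[p0 p0R] := R_nonempty ord0.
pose x0 := var (ord0, p0).
have x0X : x0 \in X by rewrite mem_variables.
have lev0 : lev x0 = 0%N by rewrite level_var.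
exists #|critical_face lev X M x0|.
  by rewrite critical_face_card // card_imset //; apply: lpvar_inj.
have famP F : F \in multichain_family lev lle X M t <-> F \subset X /\
    exists u : {ffun 'I_n -> P}, multichain u /\ forall i, var (i, u i) \in X :\: F.
  split=> [/multichain_familyP[FX _ [x /reach_multichain]]|[FX [u [mu uF]]]] //.
  apply/multichain_familyP; split=> //; last exact: multichain_reach uF.
  by move=> x _; rewrite ltnNge -ltnS ltn_ord.
apply: (@Tor_dim_family _ _ _ _ (multichain_family lev lle X M t)).
- by move=> F /famP[].
- move=> F G FG /famP[GX [u [mu uG]]]; apply/famP; split.
    exact: subset_trans GX.
  by exists u; split=> // i; apply: (subsetP (setDS X FG)).
- move=> c F FX; rewrite letterplace_idealP.
  by split=> -[->|H]; [left | right; apply/famP | left | right; case/famP: H].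
apply: betti_multichain_family => //.
- by move=> x y z; apply: le_trans.
- apply/subsetP => x; have [i [p ->]] := varP x; rewrite !mem_variables.
  exact: subsetP (min_eltsS _) p.
exact: letterplace_steps.
Qed.

End MainProof.

Theorem proposition3p14 (d : Order.disp_t) (P : finPOrderType d)
    (k : fieldType) (n : nat) (n_gt0 : (1 <= n)%N) (R : 'I_n -> {set P})
    (R_nonempty : forall j, R j != set0)
    (R_step : forall j j' : 'I_n, nat_of_ord j' = (nat_of_ord j).+1 ->
       [/\ set_le (R j) (R j'),
           #|max_elts (R j)| = width P,
           #|min_elts (R j')| = width P
         & comparability_matching (max_elts (R j)) (min_elts (R j'))]) :
  let s := (width P * (n - 1) + 1)%N in
  occurs_in_strand k s (graph_set R)
  /\ betti k (#|graph_set R| - s)%N (graph_set R) 1%N.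
Proof.
case: n n_gt0 R R_nonempty R_step => // t _ R R_nonempty R_step s.
have [i iE bi] := letterplace_last_strand k R_nonempty R_step.
rewrite /s subn1 /=; split; first by exists i, 1%N.
by rewrite -iE addnK.
Qed.
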